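(* In the setting of the context, suppose $\mathbf H$ admits dual Specht modules $\{S_\lambda\}_{\lambda\in\Lambda}$, that $\mathbf S$-mod is a highest weight category with standard modules $\{\Delta(\lambda):=\mathcal G(S_\lambda)\}_{\lambda\in\Lambda}$, and that $\mathcal R^1\mathcal G(S_\lambda)=0$ for all $\lambda\in\Lambda$. Then the Schur functor $\mathcal F$ is a 1-cover of $\mathbf H$.
   Context: Let $K$ be a field, $\mathbf S,\mathbf H$ finite-dimensional $K$-algebras, $e=e^2\in\mathbf S$ with $e\mathbf Se\cong\mathbf H$; modules are finite-dimensional left modules. $\mathcal F:\mathbf S\text{-mod}\to\mathbf H\text{-mod}$, $M\mapsto eM$; $\mathcal G:\mathbf H\text{-mod}\to\mathbf S\text{-mod}$, $N\mapsto\mathrm{Hom}_{\mathbf H}(e\mathbf S,N)$; $\mathcal R^1\mathcal G$ its first right derived functor. $\mathbf H$ admits dual Specht modules if: (i) there is a family of pairwise non-isomorphic $\mathbf H$-modules $\{S^\lambda\}_{\lambda\in\Lambda}$ indexed by a finite poset $(\Lambda,\le)$ with $\mathrm{Ext}^1_{\mathbf H}(S^\lambda,S^\mu)\ne0\Rightarrow\lambda>\mu$; (ii) there are an automorphism $\#$ and anti-automorphism $*$ of $\mathbf H$ and an order-reversing involution $\lambda\mapsto\lambda^t$ of $\Lambda$ with $S_{\lambda^t}\cong(S^\lambda)^\#$, where $V^\#$ is $V$ with $h$ acting by $h^\#$, $V^*=\mathrm{Hom}_K(V,K)$ with $(hf)(v)=f(h^*v)$, and $S_\lambda:=(S^\lambda)^*$.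 $\mathbf S$-mod is a highest weight category with standard modules $\{\Delta(\lambda)\}_{\lambda\in\Lambda}$ ($\Lambda$ a finite poset) if: (H1) $\mathrm{End}_{\mathbf S}(\Delta(\lambda))=K$; (H2) $\mathrm{Hom}_{\mathbf S}(\Delta(\lambda),\Delta(\mu))\ne0\Rightarrow\lambda\le\mu$; (H3) if $\mathrm{Hom}_{\mathbf S}(\Delta(\lambda),M)=0$ for all $\lambda$ then $M=0$; (H4) for each $\lambda$ there is a projective $P(\lambda)$ with a surjection $P(\lambda)\to\Delta(\lambda)$ whose kernel has a filtration with subquotients $\Delta(\mu)$, $\mu>\lambda$. An exact functor $\mathcal F:\mathbf S\text{-mod}\to\mathbf H\text{-mod}$ is a 1-cover of $\mathbf H$ if: (C1) $\mathbf H\cong\mathrm{End}_{\mathbf S}(P)$ for some projective $\mathbf S$-module $P$; (C2) $\mathrm{Hom}_{\mathbf S}(M,N)\cong\mathrm{Hom}_{\mathbf H}(\mathcal F M,\mathcal F N)$ for all projective $M,N$; (C3) $\mathrm{Ext}^1_{\mathbf S}(M,N)\cong\mathrm{Ext}^1_{\mathbf H}(\mathcal FM,\mathcal FN)$ for all $M,N$ having filtrations with subquotients of the form $\Delta(\lambda)$. *)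

(* Defs.v *)
(* Finite-dimensional modules over finite-dimensional
   K-algebras are encoded concretely by matrices (row-vector convention):
   a module M over A is a dimension [rdim M] and a map [ract M : A -> 'M_n],
   where a . v  :=  v *m ract M a. *)
From HB Require Import structures.
From mathcomp Require Import all_boot all_order all_algebra all_field.
Set Implicit Arguments. Unset Strict Implicit. Unset Printing Implicit Defensive.
Import Order.TTheory GRing.Theory.
Local Open Scope ring_scope.

Section Modules.
Variable K : fieldType.

Record rep (A : Type) := Rep { rdim : nat; ract : A -> 'M[K]_rdim }.

Section OverAlg.
Variable A : falgType K.

Definition is_mod (M : rep A) : Prop :=
  [/\ forall (c : K) (a b : A), ract M (c *: a + b) = c *: ract M a + ract M b,
      ract M 1 = 1%:M
    & forall a b : A, ract M (a * b) = ract M b *m ract M a].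

Definition is_hom (M N : rep A) (f : 'M[K]_(rdim M, rdim N)) : Prop :=
  forall a : A, ract M a *m f = f *m ract N a.

Definition mod_iso (M N : rep A) : Prop :=
  exists (f : 'M[K]_(rdim M, rdim N)) (g : 'M[K]_(rdim N, rdim M)),
    [/\ is_hom f, is_hom g, f *m g = 1%:M & g *m f = 1%:M].

Definition ses (M1 M2 M3 : rep A) (i : 'M[K]_(rdim M1, rdim M2))
    (p : 'M[K]_(rdim M2, rdim M3)) : Prop :=
  [/\ is_hom i, is_hom p, row_free i, row_full p & (i == kermx p)%MS].

(** Ext^1_A(M, N) = 0 : every extension 0 -> N -> E -> M -> 0 splits
    (Yoneda description of Ext^1). *)
Definition Ext1_zero (M N : rep A) : Prop :=
  forall (E : rep A) (i : 'M[K]_(rdim N, rdim E)) (p : 'M[K]_(rdim E, rdim M)),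
    is_mod E -> ses i p ->
    exists s : 'M[K]_(rdim M, rdim E), is_hom s /\ s *m p = 1%:M.

Definition ext_equiv (N M E E' : rep A)
    (i : 'M[K]_(rdim N, rdim E)) (p : 'M[K]_(rdim E, rdim M))
    (i' : 'M[K]_(rdim N, rdim E')) (p' : 'M[K]_(rdim E', rdim M)) : Prop :=
  exists g : 'M[K]_(rdim E, rdim E'), [/\ is_hom g, i *m g = i' & g *m p' = p].

Definition is_proj (P : rep A) : Prop :=
  forall (M N : rep A) (p : 'M[K]_(rdim M, rdim N)) (f : 'M[K]_(rdim P, rdim N)),
    is_mod M -> is_mod N -> is_hom p -> row_full p -> is_hom f ->
    exists h : 'M[K]_(rdim P, rdim M), is_hom h /\ h *m p = f.

Definition vco (x : A) : 'rV[K]_(\dim {:A}) := passmx.rVof (vbasis {:A}) x.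
Definition vel (r : 'rV[K]_(\dim {:A})) : A := passmx.vecof (vbasis {:A}) r.
Definition mxof (f : A -> A) : 'M[K]_(\dim {:A}) :=
  \matrix_(j < \dim {:A}) vco (f (vel (delta_mx 0 j))).

Definition regmod : rep A := Rep (fun a => mxof (fun x => a * x)).

(** Restriction of (the action on) M to the A-stable subspace spanned by U. *)
Definition subrep (M : rep A) (U : 'M[K]_(rdim M)) : rep A :=
  @Rep A (\rank U) (fun a => row_base U *m ract M a *m pinvmx (row_base U)).
Arguments subrep : clear implicits.

Definition twist (sh : A -> A) (M : rep A) : rep A :=
  Rep (fun a => ract M (sh a)).

(** K-dual V^* = Hom_K(V,K) with (h f)(v) = f(h^* v), for an anti-automorphism *. *)
Definition dualmod (st : A -> A) (M : rep A) : rep A :=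
  Rep (fun a => (ract M (st a))^T).

Definition is_alg_auto (sh : A -> A) : Prop :=
  [/\ forall (c : K) (a b : A), sh (c *: a + b) = c *: sh a + sh b,
      bijective sh, sh 1 = 1 & forall a b, sh (a * b) = sh a * sh b].

Definition is_alg_antiauto (st : A -> A) : Prop :=
  [/\ forall (c : K) (a b : A), st (c *: a + b) = c *: st a + st b,
      bijective st, st 1 = 1 & forall a b, st (a * b) = st b * st a].

End OverAlg.

Definition pull (B A : falgType K) (f : B -> A) (M : rep A) : rep B :=
  Rep (fun b => ract M (f b)).

Section Schur.
Variables (S H : falgType K) (iota : H -> S) (e : S).

(** F M = eM, an H-module via H ~= eSe (iota). *)
Definition SF (M : rep S) : rep H := @subrep H (pull iota M) (ract M e).

Definition SFhom (M N : rep S) (f : 'M[K]_(rdim M, rdim N)) :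
    'M[K]_(rdim (SF M), rdim (SF N)) :=
  row_base (ract M e) *m f *m pinvmx (row_base (ract N e)).

Definition eSmod : rep H := SF (regmod S).

(** Row space (in mxvec coordinates) of Hom_H(eS, N). *)
Definition homspace (N : rep H) : 'M[K]_(rdim eSmod * rdim N) :=
  (\bigcap_(j < \dim {:H})
     kermx (lin_mx (fun phi : 'M[K]_(rdim eSmod, rdim N) =>
        ract eSmod (vbasis {:H})`_j *m phi - phi *m ract N (vbasis {:H})`_j)))%MS.

Definition rmul_eS (s : S) : 'M[K]_(rdim eSmod) :=
  row_base (mxof (fun x : S => e * x)) *m mxof (fun x : S => x * s)
    *m pinvmx (row_base (mxof (fun x : S => e * x))).

(** G N = Hom_H(eS, N), an S-module via (s phi)(x) = phi(x s). *)
Definition SG (N : rep H) : rep S :=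
  @Rep S (\rank (homspace N)) (fun s =>
    \matrix_(j < \rank (homspace N))
       mxvec (rmul_eS s *m vec_mx (row j (row_base (homspace N))))
     *m pinvmx (row_base (homspace N))).

Definition R1G_zero (N : rep H) : Prop := Ext1_zero eSmod N.

End Schur.

Section HW.
Variables (d : Order.disp_t) (L : finPOrderType d).

(** H admits dual Specht modules {S_lam = (Sp lam)^*}, Sp lam = S^lam. *)
Definition admits_dual_Specht (H : falgType K) (Sp : L -> rep H)
    (sh st : H -> H) (t : L -> L) : Prop :=
  [/\ forall l, is_mod (Sp l),
      forall l m, mod_iso (Sp l) (Sp m) -> l = m,
      forall l m, ~ Ext1_zero (Sp l) (Sp m) -> (m < l)%O,
      [/\ is_alg_auto sh, is_alg_antiauto st,
         forall l, t (t l) = l &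
         forall l m, (l <= m)%O -> (t m <= t l)%O]
    & forall l, mod_iso (dualmod st (Sp (t l))) (twist sh (Sp l))].

Inductive Dfilt (S : falgType K) (D : L -> rep S) (P : pred L) : rep S -> Prop :=
  | Dfilt0 (M : rep S) : rdim M = 0%N -> Dfilt D P M
  | DfiltS (M M' : rep S) (mu : L) (i : 'M[K]_(rdim M', rdim M))
      (p : 'M[K]_(rdim M, rdim (D mu))) :
      P mu -> is_mod M' -> Dfilt D P M' -> ses i p -> Dfilt D P M.

Definition highest_weight (S : falgType K) (D : L -> rep S) : Prop :=
  [/\ forall l, is_mod (D l),
      (* H1 *) forall l, (0 < rdim (D l))%N /\
        forall f : 'M[K]_(rdim (D l)), is_hom f -> exists c : K, f = c%:M,
      (* H2 *) forall l m (f : 'M[K]_(rdim (D l), rdim (D m))),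
        is_hom f -> f != 0 -> (l <= m)%O,
      (* H3 *) forall M : rep S, is_mod M ->
        (forall l (f : 'M[K]_(rdim (D l), rdim M)), is_hom f -> f = 0) ->
        rdim M = 0%N
    & (* H4 *) forall l, exists (P : rep S) (p : 'M[K]_(rdim P, rdim (D l)))
        (Q : rep S) (i : 'M[K]_(rdim Q, rdim P)),
        [/\ is_mod P, is_proj P, is_mod Q, ses i p & Dfilt D (fun m => (l < m)%O) Q]].

Definition is_1cover (S H : falgType K) (iota : H -> S) (e : S) (D : L -> rep S)
    : Prop :=
  [/\
      forall (M1 M2 M3 : rep S) (i : 'M[K]_(rdim M1, rdim M2))
        (p : 'M[K]_(rdim M2, rdim M3)),
        is_mod M1 -> is_mod M2 -> is_mod M3 -> ses i p ->
        ses (SFhom iota e i) (SFhom iota e p),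
      exists (P : rep S) (phi : H -> 'M[K]_(rdim P)),
        [/\ is_mod P /\ is_proj P,
            (forall (c : K) (a b : H), phi (c *: a + b) = c *: phi a + phi b),
            injective phi,
            (forall h, is_hom (phi h)) /\ (forall f, is_hom f -> exists h, phi h = f)
          & phi 1 = 1%:M /\ forall a b, phi (a * b) = phi a *m phi b],
      forall M N : rep S, is_mod M -> is_mod N -> is_proj M -> is_proj N ->
        (forall f g : 'M[K]_(rdim M, rdim N), is_hom f -> is_hom g ->
           SFhom iota e f = SFhom iota e g -> f = g) /\
        (forall g : 'M[K]_(rdim (SF iota e M), rdim (SF iota e N)), is_hom g ->
           exists f, is_hom f /\ SFhom iota e f = g)
    &
      forall M N : rep S, is_mod M -> is_mod N ->
        Dfilt D predT M -> Dfilt D predT N ->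
        (forall (E1 E2 : rep S) (i1 : 'M[K]_(rdim N, rdim E1))
           (p1 : 'M[K]_(rdim E1, rdim M)) (i2 : 'M[K]_(rdim N, rdim E2))
           (p2 : 'M[K]_(rdim E2, rdim M)),
           is_mod E1 -> is_mod E2 -> ses i1 p1 -> ses i2 p2 ->
           ext_equiv (SFhom iota e i1) (SFhom iota e p1)
                     (SFhom iota e i2) (SFhom iota e p2) ->
           ext_equiv i1 p1 i2 p2) /\
        (forall (E' : rep H) (i' : 'M[K]_(rdim (SF iota e N), rdim E'))
           (p' : 'M[K]_(rdim E', rdim (SF iota e M))),
           is_mod E' -> ses i' p' ->
           exists (E : rep S) (i : 'M[K]_(rdim N, rdim E))
             (p : 'M[K]_(rdim E, rdim M)),
             [/\ is_mod E, ses i p &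
                 ext_equiv (SFhom iota e i) (SFhom iota e p) i' p'])].

End HW.
End Modules.

(* Main.v *)
(* The functor [G] is right adjoint to the exact functor [F], with invertible
   counit [F G X -> X].  Say that [F] is fully faithful into [N] when
   [Hom(M, N) -> Hom(F M, F N)] is bijective for every [M].  By adjunction this
   holds for [N = G X], hence for the standard modules; it passes to extensions
   and to retracts, hence to modules with a Delta-filtration and to projective
   modules, which by (H3) and (H4) are retracts of sums of the [P(lambda)].  This
   gives (C2) and the injectivity in (C3).  For the surjectivity, an extension
   [E'] of [F M] by [F N] is lifted to [G E']; the map [G E' -> M] is onto
   because [R^1 G (F N) = 0]. *)
Require Import Defs.
From Stdlib Require Import Classical_Prop.
From HB Require Import structures.
From mathcomp Require Import all_boot all_order all_algebra all_field.
Import Order.TTheory GRing.Theory.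
Local Open Scope ring_scope.

Set Implicit Arguments.
Unset Strict Implicit.

(** * Modules and extensions *)

Section Modules.
Variables (K : fieldType) (A : falgType K).
Implicit Types M N P X Y Z : rep K A.

Lemma hom1 M : is_hom (1%:M : 'M[K]_(rdim M, rdim M)).
Proof. by move=> a; rewrite mulmx1 mul1mx. Qed.

Lemma hom0 M N : is_hom (0 : 'M[K]_(rdim M, rdim N)).
Proof. by move=> a; rewrite mulmx0 mul0mx. Qed.

Lemma hom_comp M N P (f : 'M_(rdim M, rdim N)) (g : 'M_(rdim N, rdim P)) :
  is_hom f -> is_hom g -> is_hom (f *m g : 'M_(rdim M, rdim P)).
Proof. by move=> hf hg a; rewrite mulmxA hf -!mulmxA hg. Qed.

Lemma homD M N (f g : 'M_(rdim M, rdim N)) :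
  is_hom f -> is_hom g -> is_hom (f + g).
Proof. by move=> hf hg a; rewrite mulmxDl mulmxDr hf hg. Qed.

Lemma homB M N (f g : 'M_(rdim M, rdim N)) :
  is_hom f -> is_hom g -> is_hom (f - g).
Proof. by move=> hf hg a; rewrite mulmxBl mulmxBr hf hg. Qed.

Lemma hom_factor M N P (i : 'M_(rdim N, rdim P)) (f : 'M_(rdim M, rdim P)) :
  is_hom i -> row_free i -> is_hom f -> (f <= i)%MS ->
  exists g : 'M_(rdim M, rdim N), is_hom g /\ g *m i = f.
Proof.
move=> hi ifree hf /submxP[g fE]; exists g; split=> // a.
by apply: (row_free_inj ifree); rewrite /= -mulmxA -fE hf -mulmxA hi mulmxA -fE.
Qed.

(** [pinvmx p] is only a linear section of [p]. Its defect [p *m pinvmx p - 1] takes values in the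
    kernel of [p], which [f] kills, so [pinvmx p *m f] still factors [f] and is equivariant. *)
Lemma hom_descend M N P (p : 'M_(rdim M, rdim N)) (f : 'M_(rdim M, rdim P)) :
  is_hom p -> row_full p -> is_hom f -> (kermx p <= kermx f)%MS ->
  exists g : 'M_(rdim N, rdim P), is_hom g /\ p *m g = f.
Proof.
move=> hp pfull hf kle; exists (pinvmx p *m f).
have pE : p *m (pinvmx p *m f) = f.
  apply/eqP; rewrite -subr_eq0 mulmxA -[X in _ - X]mul1mx -mulmxBl.
  apply/eqP/sub_kermxP/(submx_trans _ kle)/sub_kermxP.
  by rewrite mulmxBl mul1mx mulmxKpV ?subrr.
split=> // a; apply: (row_full_inj pfull).
by rewrite [in RHS]mulmxA pE mulmxA -hp -mulmxA pE hf.
Qed.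

(** A [rep] is a bare family of matrices, so the module axioms of a constructed object have to be
    transported, here along an injective homomorphism. *)
Lemma is_mod_sub X M (k : 'M_(rdim X, rdim M)) :
  is_mod M -> is_hom k -> row_free k -> is_mod X.
Proof.
move=> [Mlin M1 Mmul] hk kfree.
split=> [c a b| |a b]; apply: (row_free_inj kfree) => /=.
- by rewrite mulmxDl -scalemxAl !hk Mlin mulmxDr -scalemxAr.
- by rewrite hk M1 mulmx1 mul1mx.
- by rewrite hk Mmul -mulmxA hk !mulmxA hk.
Qed.

Lemma is_mod_quot M X (c : 'M_(rdim M, rdim X)) :
  is_mod M -> is_hom c -> row_full c -> is_mod X.
Proof.
move=> [Mlin M1 Mmul] hc cfull.
split=> [x a b| |a b]; apply: (row_full_inj cfull).
- by rewrite -hc Mlin mulmxDr -scalemxAr mulmxDl -scalemxAl !hc.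
- by rewrite -hc M1 mulmx1 mul1mx.
- by rewrite -hc Mmul -mulmxA hc mulmxA hc -mulmxA.
Qed.

(** * Submodules, quotients, pullbacks and direct sums *)

Lemma exists_submodule M (U : 'M[K]_(rdim M)) : is_mod M ->
  (forall a, U *m ract M a <= U)%MS ->
  exists (X : rep K A) (k : 'M_(rdim X, rdim M)),
    [/\ is_mod X, is_hom k, row_free k & (k == U)%MS].
Proof.
move=> mM stab.
have stabb a : (row_base U *m ract M a <= row_base U)%MS.
  rewrite eq_row_base; apply: submx_trans (stab a).
  by rewrite submxMr // eq_row_base.
exists (subrep U), (row_base U).
have bE a : ract (subrep U) a *m row_base U = row_base U *m ract M a.
  exact: mulmxKpV.
have bfree := row_base_free U.
split=> //; last by apply/eqmxP/eq_row_base.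
exact: (is_mod_sub (X := subrep U) (k := row_base U)).
Qed.

Lemma exists_kernel M N (f : 'M_(rdim M, rdim N)) : is_mod M -> is_hom f ->
  exists (X : rep K A) (k : 'M_(rdim X, rdim M)),
    [/\ is_mod X, is_hom k, row_free k & (k == kermx f)%MS].
Proof.
move=> mM hf; apply: exists_submodule => // a.
by apply/sub_kermxP; rewrite -mulmxA hf mulmxA mulmx_ker mul0mx.
Qed.

Lemma exists_quotient M m (U : 'M[K]_(m, rdim M)) : is_mod M ->
  (forall a, U *m ract M a <= U)%MS ->
  exists (X : rep K A) (c : 'M_(rdim M, rdim X)),
    [/\ is_mod X, is_hom c, row_full c & (U == kermx c)%MS].
Proof.
move=> mM stab.
pose c := col_base (cokermx U).
have cfull : row_full c := col_base_full _.
have kU : (U == kermx c)%MS.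
  apply/andP; split.
    apply/sub_kermxP; apply: (row_free_inj (row_base_free (cokermx U))).
    by rewrite /= -mulmxA mulmx_base mulmx_coker mul0mx.
  rewrite submxE; apply/eqP.
  apply: etrans (congr1 (mulmx (kermx c)) (esym (mulmx_base (cokermx U)))) _.
  by rewrite mulmxA mulmx_ker mul0mx.
pose X : rep K A := Rep (fun a => pinvmx c *m ract M a *m c).
have hc : is_hom (M := M) (N := X) c.
  (* The defect of the linear section [pinvmx c] lies in [U], and [U] is stable under the action. *)
  have D0 a : (c *m pinvmx c - 1%:M) *m ract M a *m c = 0.
    apply/sub_kermxP; rewrite -(eqmxP kU); apply: submx_trans (stab a).
    rewrite submxMr // (eqmxP kU); apply/sub_kermxP.
    by rewrite mulmxBl mul1mx mulmxKpV ?subrr.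
  move=> a /=; apply/eqP; rewrite eq_sym -subr_eq0; apply/eqP.
  by rewrite -[RHS](D0 a) !mulmxBl mul1mx !mulmxA.
exists X, c; split=> //.
exact: (is_mod_quot (M := M) (c := c : 'M_(rdim M, rdim X))).
Qed.

(** The kernel of [f - g] on the direct sum. The two universal clauses speak of arbitrary matrices,
    so they also apply to linear sections and to single vectors; equivariance is recovered by
    [hom_jointly_monic]. *)
Lemma exists_pullback X Y Z (f : 'M_(rdim X, rdim Z)) (g : 'M_(rdim Y, rdim Z)) :
  is_mod X -> is_mod Y -> is_hom f -> is_hom g ->
  exists (E : rep K A) (p : 'M_(rdim E, rdim X)) (q : 'M_(rdim E, rdim Y)),
    [/\ is_mod E, is_hom p, is_hom q, p *m f = q *m g &
        [/\ forall m (w : 'M_(m, rdim E)), w *m p = 0 -> w *m q = 0 -> w = 0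
          & forall m (u : 'M_(m, rdim X)) (v : 'M_(m, rdim Y)),
              u *m f = v *m g -> exists w, w *m p = u /\ w *m q = v]].
Proof.
move=> [Xlin X1 Xmul] [Ylin Y1 Ymul] hf hg.
pose D : rep K A := Rep (fun a => block_mx (ract X a) 0 0 (ract Y a)).
have mD : is_mod D.
  split=> [c a b| |a b] /=.
  - by rewrite Xlin Ylin scale_block_mx add_block_mx !scaler0 !addr0.
  - by rewrite X1 Y1 -scalar_mx_block.
  - by rewrite mulmx_block !mul0mx !mulmx0 !addr0 !add0r Xmul Ymul.
have hfg : is_hom (M := D) (N := Z) (col_mx f (- g)).
  move=> a /=; rewrite mul_block_col !mul0mx addr0 add0r mul_col_mx.
  by rewrite mulmxN hf hg mulNmx.
have [E [k [mE hk kfree kE]]] := exists_kernel mD hfg.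
have kD := hsubmxK (k : 'M_(rdim E, rdim X + rdim Y)).
set p := lsubmx _ in kD; set q := rsubmx _ in kD.
have hpq a : ract E a *m p = p *m ract X a /\ ract E a *m q = q *m ract Y a.
  move: (hk a); rewrite -kD mul_mx_row /= mul_row_block !mulmx0 addr0 add0r.
  by case/eq_row_mx.
exists E, p, q; split=> //.
- by move=> a; have [] := hpq a.
- by move=> a; have [] := hpq a.
- have: k *m col_mx f (- g) = 0 by apply/sub_kermxP; rewrite (eqmxP kE).
  by rewrite -kD mul_row_col mulmxN => /eqP; rewrite subr_eq0 => /eqP.
split=> [m w wp wq|m u v uv].
  apply: (row_free_inj kfree); rewrite /= mul0mx -kD mul_mx_row wp wq.
  by rewrite row_mx0.
have: (row_mx u v <= k)%MS.
  rewrite (eqmxP kE); apply/sub_kermxP.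
  by rewrite mul_row_col mulmxN uv subrr.
case/submxP=> w; rewrite -kD mul_mx_row => /eq_row_mx[-> ->].
by exists w.
Qed.

Lemma hom_jointly_monic X Y Z W (p : 'M_(rdim W, rdim X))
    (q : 'M_(rdim W, rdim Y)) (w : 'M_(rdim Z, rdim W)) :
  (forall m (u : 'M_(m, rdim W)), u *m p = 0 -> u *m q = 0 -> u = 0) ->
  is_hom p -> is_hom q -> is_hom (w *m p : 'M_(rdim Z, rdim X)) ->
  is_hom (w *m q : 'M_(rdim Z, rdim Y)) -> is_hom w.
Proof.
move=> inj hp hq hwp hwq a; apply/eqP; rewrite -subr_eq0; apply/eqP.
apply: inj; rewrite mulmxBl -!mulmxA ?hp ?hq.
  by rewrite hwp mulmxA subrr.
by rewrite hwq mulmxA subrr.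
Qed.

(** The sum is the pullback over the zero module [Z]; its inclusions are the pairs [(1, 0)] and
    [(0, 1)]. *)
Lemma exists_dsum X Y : is_mod X -> is_mod Y ->
  exists (E : rep K A) (i : 'M_(rdim X, rdim E)) (j : 'M_(rdim Y, rdim E))
         (p : 'M_(rdim E, rdim X)) (q : 'M_(rdim E, rdim Y)),
    [/\ is_mod E, is_hom p, is_hom j /\ j *m q = 1%:M, is_hom q & ses i q]
    /\ i *m p = 1%:M.
Proof.
move=> mX mY; pose Z : rep K A := @Rep K A 0 (fun _ => 0).
have h0 M : is_hom (M := M) (N := Z) 0 by apply: hom0.
have [E [p [q [mE hp hq _ [inj sur]]]]] := exists_pullback mX mY (h0 X) (h0 Y).
have [i [ip iq]] := sur _ 1%:M 0 (etrans (thinmx0 _) (esym (thinmx0 _))).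
have [j [jp jq]] := sur _ 0 1%:M (etrans (thinmx0 _) (esym (thinmx0 _))).
exists E, i, j, p, q; split=> //; split=> //.
  split=> //; apply: (hom_jointly_monic inj) => //; rewrite ?jp ?jq.
    exact: hom0.
  exact: hom1.
split=> //.
- apply: (hom_jointly_monic inj) => //; rewrite ?ip ?iq.
    exact: hom1.
  exact: hom0.
- by apply/row_freeP; exists p.
- by apply/row_fullP; exists j.
apply/andP; split; first exact/sub_kermxP.
apply/submxP; exists (kermx q *m p); apply/eqP; rewrite -subr_eq0; apply/eqP.
apply: inj; first by rewrite mulmxBl -(mulmxA _ i p) ip mulmx1 subrr.
by rewrite mulmxBl mulmx_ker -(mulmxA _ i q) iq mulmx0 subrr.
Qed.

(** * Short exact sequences and lifting *)

Lemma ses0 M1 M2 M3 (i : 'M_(rdim M1, rdim M2)) (p : 'M_(rdim M2, rdim M3)) :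
  ses i p -> i *m p = 0.
Proof. by case=> _ _ _ _ kE; apply/sub_kermxP; rewrite (eqmxP kE). Qed.

Lemma ses_factor M1 M2 M3 X (i : 'M_(rdim M1, rdim M2))
    (p : 'M_(rdim M2, rdim M3)) (f : 'M_(rdim X, rdim M2)) :
  ses i p -> is_hom f -> f *m p = 0 ->
  exists g : 'M_(rdim X, rdim M1), is_hom g /\ g *m i = f.
Proof.
case=> hi _ ifree _ kE hf fp; apply: hom_factor => //.
by rewrite (eqmxP kE); apply/sub_kermxP.
Qed.

Lemma hom_inverse M N (f : 'M_(rdim M, rdim N)) :
  is_hom f -> row_free f -> row_full f ->
  exists g : 'M_(rdim N, rdim M), [/\ is_hom g, f *m g = 1%:M & g *m f = 1%:M].
Proof.
move=> hf ffree ffull.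
have [|g [hg gf]] := hom_factor hf ffree (@hom1 N); first by rewrite sub1mx.
exists g; split=> //; apply: (row_free_inj ffree).
by rewrite /= -mulmxA gf mulmx1 mul1mx.
Qed.

(** The vanishing of Ext^1(Q, N), with an arbitrary [Y] in place of [Q] as the cokernel. In this
    form it passes to extensions in [N] without a long exact sequence. *)
Definition lifts (Q N : rep K A) : Prop :=
  forall (X Y : rep K A) (i : 'M_(rdim N, rdim X)) (p : 'M_(rdim X, rdim Y))
    (f : 'M_(rdim Q, rdim Y)),
  is_mod X -> is_mod Y -> ses i p -> is_hom f ->
  exists g : 'M_(rdim Q, rdim X), is_hom g /\ g *m p = f.

(** Pulling the sequence back along [f] gives an extension of [Q] by [N]; a section of it, followed
    by the projection to [X], lifts [f]. *)
Lemma Ext1_zero_lifts (Q N : rep K A) :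
  is_mod Q -> Ext1_zero Q N -> lifts Q N.
Proof.
move=> mQ extQN X Y i p f mX mY ip hf.
have [hi hp ifree pfull kE] := ip.
have [E [r [s [mE hr hs rs [inj sur]]]]] := exists_pullback mX mQ hp hf.
have [j [jr js]] : exists j, j *m r = i /\ j *m s = 0.
  by apply: sur; rewrite (ses0 ip) mul0mx.
have js_ses : ses j s.
  split=> //.
  - by apply: (hom_jointly_monic inj); rewrite ?jr ?js //; apply: hom0.
  - have [c ic] := row_freeP ifree; apply/row_freeP; exists (r *m c).
    by rewrite mulmxA jr.
  - have [|w [_ ws]] := sur _ (f *m pinvmx p) 1%:M.
      by rewrite mul1mx -mulmxA mulVpmx ?mulmx1.
    by apply/row_fullP; exists w.
  - apply/andP; split; first exact/sub_kermxP.
    have /submxP[c cE] : (kermx s *m r <= i)%MS.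
      rewrite (eqmxP kE); apply/sub_kermxP.
      by rewrite -mulmxA rs mulmxA mulmx_ker mul0mx.
    apply/submxP; exists c; apply/eqP; rewrite -subr_eq0; apply/eqP.
    apply: inj; first by rewrite mulmxBl cE -mulmxA jr subrr.
    by rewrite mulmxBl mulmx_ker -mulmxA js mulmx0 subrr.
have [t [ht ts]] := extQN _ _ _ mE js_ses.
exists (t *m r); split; first exact: hom_comp hr.
by rewrite -mulmxA rs mulmxA ts mul1mx.
Qed.

(** Serves to pass from [X] to [F (G X)], which is only isomorphic to it. *)
Lemma lifts_iso (Q N N' : rep K A) : mod_iso N N' -> lifts Q N' -> lifts Q N.
Proof.
move=> [g [h [hg hh gh hg1]]] lQ X Y i p f mX mY [hi hp ifree pfull kE] hf.
apply: (lQ _ _ (h *m i)) => //; split=> //; first exact: hom_comp hi.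
  have [c ic] := row_freeP ifree; apply/row_freeP; exists (c *m g).
  by rewrite mulmxA -(mulmxA h) ic mulmx1.
apply/andP; split; rewrite -(eqmxP kE); first exact: submxMl.
by apply/submxP; exists g; rewrite mulmxA gh mul1mx.
Qed.

(** The lift is made in two stages: first to the quotient [Z] of [X] by the image of [N1], which is
    an extension of [Y] by [N2], and then along [X -> Z], whose kernel is [N1]. *)
Lemma lifts_ext (Q N1 N N2 : rep K A) (j : 'M_(rdim N1, rdim N))
    (s : 'M_(rdim N, rdim N2)) :
  ses j s -> lifts Q N1 -> lifts Q N2 -> lifts Q N.
Proof.
move=> js l1 l2 X Y i p f mX mY ip hf.
have [hj hs jfree sfull kjs] := js; have [hi hp ifree pfull kip] := ip.
have hji : is_hom (M := N1) (N := X) (j *m i) by apply: hom_comp hi.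
have stab a : (j *m i *m ract X a <= j *m i)%MS by rewrite -hji submxMl.
have [Z [c [mZ hc cfull kc]]] := exists_quotient mX stab.
have jic : j *m i *m c = 0 by apply/sub_kermxP; rewrite (eqmxP kc).
have [|p' [hp' cp']] := hom_descend hc cfull hp.
  rewrite -(eqmxP kc); apply/sub_kermxP.
  by rewrite -mulmxA (ses0 ip) mulmx0.
have hic : is_hom (M := N) (N := Z) (i *m c) by apply: hom_comp hc.
have [|i' [hi' si']] := hom_descend hs sfull hic.
  by rewrite -(eqmxP kjs); apply/sub_kermxP; rewrite mulmxA.
have ip'_ses : ses i' p'.
  split=> //.
  - rewrite -kermx_eq0; apply/eqP.
    set k := kermx i'; have [t tE] : exists t, t *m s = k.
      by exists (k *m pinvmx s); rewrite -mulmxA mulVpmx ?mulmx1.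
    have : (t *m i <= j *m i)%MS.
      rewrite (eqmxP kc); apply/sub_kermxP.
      by rewrite -mulmxA -si' mulmxA tE mulmx_ker.
    rewrite submxMfree // => /submxP[u tu].
    by rewrite -tE tu -mulmxA (ses0 js) mulmx0.
  - have [w wp] := row_fullP pfull; apply/row_fullP; exists (w *m c).
    by rewrite -mulmxA cp'.
  apply/andP; split.
    apply/sub_kermxP; apply: (row_full_inj sfull).
    by rewrite mulmxA si' -mulmxA cp' (ses0 ip) mulmx0.
  set k := kermx p'; have [t tE] : exists t, t *m c = k.
    by exists (k *m pinvmx c); rewrite -mulmxA mulVpmx ?mulmx1.
  have : (t <= i)%MS.
    rewrite (eqmxP kip); apply/sub_kermxP.
    by rewrite -cp' mulmxA tE mulmx_ker.
  case/submxP=> u tu; apply/submxP; exists (u *m s).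
  by rewrite -mulmxA si' mulmxA -tu tE.
have [g [hg gp]] := l2 _ _ _ _ _ mZ mY ip'_ses hf.
have jic_ses : ses (j *m i) c.
  split=> //; first by rewrite /row_free mxrankMfree.
have [h [hh hE]] := l1 _ _ _ _ _ mX mZ jic_ses hg.
by exists h; split=> //; rewrite -cp' mulmxA hE.
Qed.

End Modules.

(** * The regular module *)

Section Coordinates.
Variables (K : fieldType) (A : falgType K).

Lemma vcoK : cancel (@vco K A) (@vel K A).
Proof. exact: passmx.rVofK (vbasisP _). Qed.

Lemma velK : cancel (@vel K A) (@vco K A).
Proof. exact: passmx.vecofK (vbasisP _). Qed.

Lemma vcoP (c : K) (x y : A) : vco (c *: x + y) = c *: vco x + vco y.
Proof. exact: passmx.rVof_linear. Qed.

Lemma velP (c : K) (x y : 'rV[K]_(\dim {:A})) :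
  vel (c *: x + y) = c *: vel x + vel y.
Proof. exact: passmx.vecof_linear. Qed.

(** Several matrices, such as the action on [SG], are given row by row as values of a linear map;
    this evaluates them on an arbitrary vector. *)
Lemma mulmx_rows n m p (V : 'M[K]_(n, m)) (g : 'rV[K]_m -> 'rV[K]_p) v :
  linear g -> v *m (\matrix_(j < n) g (row j V)) = g (v *m V).
Proof.
move=> glin.
pose gl : {linear 'rV_m -> 'rV_p} := HB.pack g
  (GRing.isSemilinear.Build K _ _ _ g (GRing.semilinear_linear glin)).
rewrite -[g]/(gl : _ -> _) mulmx_sum_row mulmx_sum_row linear_sum.
by apply: eq_bigr => j _; rewrite linearZ rowK.
Qed.

Lemma mulmx_deltas n p (g : 'rV[K]_n -> 'rV[K]_p) v :
  linear g -> v *m (\matrix_(j < n) g (delta_mx 0 j)) = g v.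
Proof.
move=> glin; rewrite -[in RHS](mulmx1 v) -mulmx_rows //; congr (_ *m _).
by apply/row_matrixP=> j; rewrite !rowK row1.
Qed.

Lemma vco_matrix n (f : A -> 'rV[K]_n) x : linear f ->
  vco x *m (\matrix_(j < \dim {:A}) f (vel (delta_mx 0 j))) = f x.
Proof.
move=> flin; rewrite (mulmx_deltas (g := f \o @vel K A)) /= ?vcoK //.
by move=> c u v /=; rewrite velP flin.
Qed.

Lemma vco_mxof (f : A -> A) x : linear f -> vco x *m mxof f = vco (f x).
Proof.
move=> flin; rewrite /mxof (vco_matrix (f := @vco K A \o f)) //.
by move=> c u v /=; rewrite flin vcoP.
Qed.

(** [vco x] retyped over [rdim (regmod A)], so that it composes with matrices of homomorphisms. *)
Definition rvec (x : A) : 'rV[K]_(rdim (regmod A)) := vco x.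

Lemma rvecP (c : K) (x y : A) : rvec (c *: x + y) = c *: rvec x + rvec y.
Proof. exact: vcoP. Qed.

Lemma eq_rvec_mx n (B C : 'M[K]_(rdim (regmod A), n)) :
  (forall x, rvec x *m B = rvec x *m C) -> B = C.
Proof.
move=> BC; apply/row_matrixP=> j; rewrite !rowE.
by have := BC (vel (delta_mx 0 j)); rewrite /rvec velK.
Qed.

Lemma mull_linear (a : A) : linear (fun x : A => a * x).
Proof. by move=> c u v; rewrite mulrDr scalerAr. Qed.

Lemma mulr_linear (a : A) : linear (fun x : A => x * a).
Proof. by move=> c u v; rewrite mulrDl scalerAl. Qed.

Lemma rvec_ract (a x : A) : rvec x *m ract (regmod A) a = rvec (a * x).
Proof. exact: vco_mxof (mull_linear a). Qed.

Definition rmulmx (a : A) : 'M[K]_(rdim (regmod A)) := mxof (fun x => x * a).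

Lemma rvec_rmulmx (a x : A) : rvec x *m rmulmx a = rvec (x * a).
Proof. exact: vco_mxof (mulr_linear a). Qed.

Lemma is_mod_regmod : is_mod (regmod A).
Proof.
split=> [c a b| |a b]; apply: eq_rvec_mx => x.
- by rewrite mulmxDr -scalemxAr !rvec_ract mulrDl -scalerAl rvecP.
- by rewrite rvec_ract mul1r mulmx1.
- by rewrite mulmxA !rvec_ract mulrA.
Qed.

Lemma rmulmx_hom (a : A) : is_hom (rmulmx a).
Proof.
move=> b; apply: eq_rvec_mx => x.
by rewrite !mulmxA rvec_ract rvec_rmulmx rvec_rmulmx rvec_ract mulrA.
Qed.

Lemma rmulmxP (c : K) (a b : A) :
  rmulmx (c *: a + b) = c *: rmulmx a + rmulmx b.
Proof.
apply: eq_rvec_mx => x.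
by rewrite mulmxDr -scalemxAr !rvec_rmulmx mulrDr -scalerAr rvecP.
Qed.

Lemma rmulmx1 : rmulmx 1 = 1%:M.
Proof. by apply: eq_rvec_mx => x; rewrite rvec_rmulmx mulr1 mulmx1. Qed.

(** Row vectors compose from left to right, so right multiplication preserves the order of products
    and no opposite algebra arises. *)
Lemma rmulmxM (a b : A) : rmulmx (a * b) = rmulmx a *m rmulmx b.
Proof. by apply: eq_rvec_mx => x; rewrite mulmxA !rvec_rmulmx mulrA. Qed.

Lemma rmulmx_inj : injective rmulmx.
Proof.
move=> a b /(congr1 (mulmx (rvec 1))); rewrite !rvec_rmulmx !mul1r.
exact: can_inj vcoK _ _.
Qed.

(** The map [x |-> x . m] from the regular module, corresponding to [m] under the identification of
    Hom(A, M) with [M]. *)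
Definition orbmx (M : rep K A) (m : 'rV_(rdim M)) :
    'M[K]_(rdim (regmod A), rdim M) :=
  \matrix_(j < rdim (regmod A)) (m *m ract M (vel (delta_mx 0 j))).

Lemma rvec_orbmx (M : rep K A) (m : 'rV_(rdim M)) x : is_mod M ->
  rvec x *m orbmx m = m *m ract M x.
Proof.
case=> Mlin _ _; apply: (vco_matrix (f := fun x => m *m ract M x)).
by move=> c a b; rewrite Mlin mulmxDr -scalemxAr.
Qed.

Lemma orbmx_hom (M : rep K A) (m : 'rV_(rdim M)) : is_mod M ->
  is_hom (orbmx m).
Proof.
move=> mM a; apply: eq_rvec_mx => x; rewrite !mulmxA rvec_ract !rvec_orbmx //.
by case: mM => _ _ ->; rewrite mulmxA.
Qed.

(** [homspace] tests equivariance on a basis of the algebra only; linearity of both actions extends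
    it. *)
Lemma hom_on_basis (M N : rep K A) (f : 'M_(rdim M, rdim N)) :
  is_mod M -> is_mod N ->
  (forall j : 'I_(\dim {:A}),
     ract M (vbasis {:A})`_j *m f = f *m ract N (vbasis {:A})`_j) ->
  is_hom f.
Proof.
move=> [Mlin _ _] [Nlin _ _] fb a.
pose rM : {linear A -> 'M[K]_(rdim M)} := HB.pack (ract M)
  (GRing.isSemilinear.Build K _ _ _ (ract M) (GRing.semilinear_linear Mlin)).
pose rN : {linear A -> 'M[K]_(rdim N)} := HB.pack (ract N)
  (GRing.isSemilinear.Build K _ _ _ (ract N) (GRing.semilinear_linear Nlin)).
rewrite -[ract M]/(rM : _ -> _) -[ract N]/(rN : _ -> _).
rewrite (coord_vbasis (memvf a)) !linear_sum mulmx_suml.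
by apply: eq_bigr => j _; rewrite !linearZ -scalemxAl /= fb.
Qed.

End Coordinates.

(** * The Schur functor *)

Section SchurFunctor.
Variables (K : fieldType) (S H : falgType K) (e : S) (iota : H -> S).
Hypothesis ee : e * e = e.
Hypothesis iota_lin :
  forall (c : K) (a b : H), iota (c *: a + b) = c *: iota a + iota b.
Hypothesis iota_inj : injective iota.
Hypothesis iota1 : iota 1 = e.
Hypothesis iotaM : forall a b : H, iota (a * b) = iota a * iota b.
Hypothesis iota_onto : forall s : S, exists h : H, iota h = e * s * e.
Implicit Types M N P : rep K S.
Implicit Types X Y : rep K H.

Local Notation F := (SF iota e).
Local Notation Fhom := (SFhom iota e).

(* [einc] and [eproj] split the idempotent [ract M e].  They are locked so that
   rewriting with [mulmxA] does not unfold them into products. *)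
Definition einc M : 'M_(rdim (F M), rdim M) :=
  locked (row_base (ract M e)).
Definition eproj M : 'M_(rdim M, rdim (F M)) :=
  locked (ract M e *m pinvmx (row_base (ract M e))).

Lemma eincE M : einc M = row_base (ract M e).
Proof. by rewrite /einc -lock. Qed.

Lemma eprojE M : eproj M = ract M e *m pinvmx (einc M).
Proof. by rewrite /eproj -lock eincE. Qed.

Lemma iota_er h : iota h * e = iota h.
Proof. by rewrite -iota1 -iotaM mulr1. Qed.

Lemma iota_el h : e * iota h = iota h.
Proof. by rewrite -iota1 -iotaM mul1r. Qed.

Lemma eproj_einc M : eproj M *m einc M = ract M e.
Proof. by rewrite eprojE mulmxKpV // eincE eq_row_base. Qed.

Lemma eincK M : is_mod M -> einc M *m ract M e = einc M.
Proof.
case=> _ _ Mmul; have /submxP[D DE] : (einc M <= ract M e)%MS.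
  by rewrite eincE eq_row_base.
by rewrite [in LHS]DE -mulmxA -Mmul ee -DE.
Qed.

Lemma einc_free M : row_free (einc M).
Proof. by rewrite eincE row_base_free. Qed.

Lemma einc_monic M m (f g : 'M_(m, rdim (F M))) :
  f *m einc M = g *m einc M -> f = g.
Proof. by move=> fg; apply: (row_free_inj (einc_free M)). Qed.

Lemma einc_eproj M : is_mod M -> einc M *m eproj M = 1%:M.
Proof.
move=> mM; apply: einc_monic.
by rewrite -mulmxA eproj_einc eincK // mul1mx.
Qed.

Lemma eprojK M : is_mod M -> ract M e *m eproj M = eproj M.
Proof. by move=> [_ _ Mmul]; rewrite eprojE mulmxA -Mmul ee. Qed.

(** [SF] uses [pinvmx] of the base directly. Projecting to [e M] first changes nothing, because
    [e * iota h = iota h]. *)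
Lemma ract_SF M h : is_mod M ->
  ract (F M) h = einc M *m ract M (iota h) *m eproj M.
Proof.
move=> mM; have [_ _ Mmul] := mM.
rewrite eprojE mulmxA -(mulmxA (einc M)) -Mmul iota_el eincE //.
Qed.

Lemma einc_equiv M h : is_mod M ->
  ract (F M) h *m einc M = einc M *m ract M (iota h).
Proof.
move=> mM; have [_ _ Mmul] := mM.
by rewrite ract_SF // -mulmxA eproj_einc -mulmxA -Mmul iota_el.
Qed.

Lemma eproj_equiv M h : is_mod M ->
  ract M (iota h) *m eproj M = eproj M *m ract (F M) h.
Proof.
move=> mM; have [_ _ Mmul] := mM.
by rewrite ract_SF // !mulmxA eproj_einc -Mmul iota_er.
Qed.

Lemma is_mod_SF M : is_mod M -> is_mod (F M).
Proof.
move=> mM; have [Mlin M1 Mmul] := mM.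
split=> [c a b| |a b]; apply: einc_monic.
- rewrite mulmxDl -scalemxAl !einc_equiv //.
  by rewrite iota_lin Mlin mulmxDr -scalemxAr.
- by rewrite einc_equiv // iota1 eincK // mul1mx.
- rewrite einc_equiv // iotaM Mmul -[RHS]mulmxA einc_equiv //.
  by rewrite [RHS]mulmxA einc_equiv // mulmxA.
Qed.

Lemma SFhomE M N (f : 'M_(rdim M, rdim N)) : is_mod M -> is_hom f ->
  Fhom f = einc M *m f *m eproj N.
Proof.
move=> mM hf; rewrite eprojE mulmxA -(mulmxA (einc M)) -hf mulmxA.
by rewrite eincK // !eincE.
Qed.

Lemma SFhom_einc M N (f : 'M_(rdim M, rdim N)) : is_mod M -> is_hom f ->
  Fhom f *m einc N = einc M *m f.
Proof.
move=> mM hf.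
by rewrite SFhomE // -mulmxA eproj_einc -mulmxA -hf mulmxA eincK.
Qed.

Lemma eproj_SFhom M N (f : 'M_(rdim M, rdim N)) : is_mod M -> is_mod N ->
  is_hom f -> eproj M *m Fhom f = f *m eproj N.
Proof.
move=> mM mN hf.
by rewrite SFhomE // !mulmxA eproj_einc hf -mulmxA eprojK.
Qed.

Lemma SFhom_hom M N (f : 'M_(rdim M, rdim N)) : is_mod M -> is_mod N ->
  is_hom f -> is_hom (Fhom f).
Proof.
move=> mM mN hf h; apply: einc_monic.
rewrite -[LHS]mulmxA SFhom_einc // mulmxA einc_equiv //.
rewrite -[RHS]mulmxA einc_equiv // [RHS]mulmxA SFhom_einc //.
by rewrite -mulmxA hf mulmxA.
Qed.

Lemma SFhomM M N P (f : 'M_(rdim M, rdim N)) (g : 'M_(rdim N, rdim P)) :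
  is_mod M -> is_mod N -> is_hom f -> is_hom g ->
  Fhom (f *m g : 'M_(rdim M, rdim P)) = Fhom f *m Fhom g.
Proof.
move=> mM mN hf hg; apply: einc_monic.
rewrite SFhom_einc //; last exact: hom_comp hg.
by rewrite -[RHS]mulmxA SFhom_einc // [RHS]mulmxA SFhom_einc // mulmxA.
Qed.

Lemma SFhom1 M : is_mod M -> Fhom (1%:M : 'M_(rdim M, rdim M)) = 1%:M.
Proof.
by move=> mM; rewrite SFhomE ?mulmx1 ?einc_eproj //; apply: hom1.
Qed.

Lemma SFhomB M N (f g : 'M_(rdim M, rdim N)) : Fhom (f - g) = Fhom f - Fhom g.
Proof. by rewrite /SFhom mulmxBr mulmxBl. Qed.

Lemma SFhomD M N (f g : 'M_(rdim M, rdim N)) : Fhom (f + g) = Fhom f + Fhom g.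
Proof. by rewrite /SFhom mulmxDr mulmxDl. Qed.

Lemma SFhomZ M N c (f : 'M_(rdim M, rdim N)) : Fhom (c *: f) = c *: Fhom f.
Proof. by rewrite /SFhom -scalemxAr -scalemxAl. Qed.

Lemma SFhom0 M N : Fhom (0 : 'M_(rdim M, rdim N)) = 0.
Proof. by rewrite /SFhom mulmx0 mul0mx. Qed.

Lemma SFhom_free M N (f : 'M_(rdim M, rdim N)) : is_mod M -> is_hom f ->
  row_free f -> row_free (Fhom f).
Proof.
move=> mM hf ffree; have := einc_free M.
rewrite /row_free -(mxrankMfree _ ffree) -SFhom_einc //.
by rewrite mxrankMfree // einc_free.
Qed.

Lemma SFhom_full M N (f : 'M_(rdim M, rdim N)) : is_mod M -> is_mod N ->
  is_hom f -> row_full f -> row_full (Fhom f).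
Proof.
move=> mM mN hf /row_fullP[g gf]; apply/row_fullP.
exists (einc N *m g *m eproj M).
by rewrite -mulmxA eproj_SFhom // mulmxA -(mulmxA _ g) gf mulmx1 einc_eproj.
Qed.

(** [einc] and [eproj] are natural and split [e M] off [M]: a preimage found in [M1] is carried back
    to [F M1] by [eproj]. *)
Lemma SFhom_ses M1 M2 M3 (i : 'M_(rdim M1, rdim M2))
    (p : 'M_(rdim M2, rdim M3)) : is_mod M1 -> is_mod M2 -> is_mod M3 ->
  ses i p -> ses (Fhom i) (Fhom p).
Proof.
move=> m1 m2 m3 ip; have [hi hp ifree pfull kE] := ip.
split; try exact: SFhom_hom; [exact: SFhom_free | exact: SFhom_full | ].
apply/andP; split.
  by apply/sub_kermxP; rewrite -SFhomM // (ses0 ip) SFhom0.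
set k := kermx _; have /submxP[c cE] : (k *m einc M2 <= i)%MS.
  rewrite (eqmxP kE); apply/sub_kermxP.
  by rewrite -mulmxA -SFhom_einc // mulmxA mulmx_ker mul0mx.
apply/submxP; exists (c *m eproj M1).
rewrite -mulmxA eproj_SFhom // mulmxA -cE -mulmxA einc_eproj // mulmx1 //.
Qed.

(** * The right adjoint of the Schur functor *)

Section Coinduction.
Variable N : rep K H.
Hypothesis mN : is_mod N.

Local Notation R := (regmod S).
Local Notation G := (SG iota e N).
Local Notation eS := (F (regmod S)).

Lemma homspaceP (phi : 'M_(rdim eS, rdim N)) :
  (mxvec phi <= homspace iota e N)%MS <-> is_hom phi.
Proof.
pose g j (phi : 'M_(rdim eS, rdim N)) :=
  ract eS (vbasis {:H})`_j *m phi - phi *m ract N (vbasis {:H})`_j.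
have glin j : linear (g j).
  move=> c u v; rewrite /g mulmxDr mulmxDl -scalemxAr -scalemxAl.
  by rewrite scalerBr opprD addrACA.
have gE j : (mxvec phi <= kermx (lin_mx (g j)))%MS <-> g j phi = 0.
  pose gl : {linear 'M_(rdim eS, rdim N) -> 'M_(rdim eS, rdim N)} :=
    HB.pack (g j)
      (GRing.isSemilinear.Build K _ _ _ (g j) (GRing.semilinear_linear (glin j))).
  have lE : mxvec phi *m lin_mx (g j) = mxvec (g j phi).
    exact: (mul_vec_lin gl).
  split=> [/sub_kermxP|g0]; last by apply/sub_kermxP; rewrite lE g0 linear0.
  by rewrite lE => /eqP; rewrite mxvec_eq0 => /eqP.
split=> [/sub_bigcapmxP sub|hphi].
  apply: hom_on_basis (is_mod_SF (is_mod_regmod S)) mN _ => j.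
  by apply/eqP; rewrite -subr_eq0; apply/eqP; apply/(gE j)/sub.
by apply/sub_bigcapmxP => j _; apply/(gE j); rewrite /g hphi subrr.
Qed.

(* The homomorphism [eS -> N] with coordinate vector [v]. *)
Definition phi_of (v : 'rV_(rdim G)) : 'M_(rdim eS, rdim N) :=
  vec_mx (v *m row_base (homspace iota e N)).

Definition of_phi (phi : 'M_(rdim eS, rdim N)) : 'rV_(rdim G) :=
  mxvec phi *m pinvmx (row_base (homspace iota e N)).

Lemma phi_of_linear : linear phi_of.
Proof. by move=> c u v; rewrite /phi_of mulmxDl -scalemxAl linearP. Qed.

Lemma of_phi_linear : linear of_phi.
Proof. by move=> c u v; rewrite /of_phi linearP mulmxDl -scalemxAl. Qed.

Lemma phi_of_hom v : is_hom (phi_of v).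
Proof.
apply/homspaceP; rewrite /phi_of vec_mxK.
by rewrite -(eq_row_base (homspace _ _ _)) submxMl.
Qed.

Lemma of_phiK phi : is_hom phi -> phi_of (of_phi phi) = phi.
Proof.
move=> /homspaceP hphi; rewrite /phi_of /of_phi mulmxKpV ?mxvecK //.
by rewrite eq_row_base.
Qed.

Lemma phi_of_inj : injective phi_of.
Proof.
move=> u v /(can_inj vec_mxK) uv.
by apply: (row_free_inj (row_base_free (homspace iota e N))).
Qed.

(** [rmul_eS s] unfolds to [F] applied to right multiplication by [s], so the module axioms of [G]
    will follow from functoriality. *)
Lemma phi_of_ract v s :
  phi_of (v *m ract G s) = SFhom iota e (rmulmx s) *m phi_of v.
Proof.
set r := SFhom _ _ _.
have hr : is_hom (M := eS) (N := eS) r.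
  exact: SFhom_hom (is_mod_regmod S) (is_mod_regmod S) (rmulmx_hom s).
pose g w := mxvec (r *m vec_mx w : 'M_(rdim eS, rdim N)).
have glin : linear g.
  by move=> c u w; rewrite /g linearP mulmxDr -scalemxAr linearP.
have -> : v *m ract G s = of_phi (r *m phi_of v).
  rewrite /of_phi -[mxvec _]/(g _) -(mulmx_rows _ v glin) -mulmxA.
  by [].
by rewrite of_phiK //; apply: (hom_comp hr (phi_of_hom v)).
Qed.

Lemma eq_phi_of m (B C : 'M_(m, rdim G)) :
  (forall v, phi_of (v *m B) = phi_of (v *m C)) -> B = C.
Proof.
by move=> BC; apply/row_matrixP=> j; rewrite !rowE; apply: phi_of_inj.
Qed.

Lemma is_mod_SG : is_mod G.
Proof.
have mR := is_mod_regmod S.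
split=> [c a b| |a b]; apply: eq_phi_of => v.
- rewrite mulmxDr -scalemxAr phi_of_linear !phi_of_ract rmulmxP.
  by rewrite SFhomD SFhomZ mulmxDl -scalemxAl.
- by rewrite phi_of_ract rmulmx1 SFhom1 // mul1mx mulmx1.
rewrite mulmxA !phi_of_ract rmulmxM SFhomM ?mulmxA //; exact: rmulmx_hom.
Qed.

(* The counit [phi |-> phi(e)] of the adjunction between [F] and [G]. *)
Definition ev : 'M_(rdim G, rdim N) :=
  \matrix_(j < rdim G) (rvec 1 *m eproj R *m phi_of (delta_mx 0 j)).

Lemma mul_ev v : v *m ev = rvec 1 *m eproj R *m phi_of v.
Proof.
rewrite /ev (mulmx_deltas (g := fun v => rvec 1 *m eproj R *m phi_of v)) //.
by move=> c u w; rewrite phi_of_linear mulmxDr -scalemxAr.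
Qed.

(** This is (s phi)(e) = phi(e s). As [s] varies, [e s] runs through [eS], so these values determine
    phi. *)
Lemma ract_ev v s : v *m ract G s *m ev = rvec s *m eproj R *m phi_of v.
Proof.
have mR := is_mod_regmod S.
rewrite mul_ev phi_of_ract mulmxA -(mulmxA (rvec 1) (eproj R)).
rewrite eproj_SFhom //; last exact: rmulmx_hom.
by rewrite mulmxA rvec_rmulmx mul1r.
Qed.

Lemma eq_mx_rowvec m n (B C : 'M[K]_(m, n)) :
  (forall v : 'rV_m, v *m B = v *m C) -> B = C.
Proof. by move=> BC; apply/row_matrixP=> j; rewrite !rowE. Qed.

(** With a = [iota h] in [eSe]: (a phi)(e) = phi(e a) = phi(a e) = h phi(e). *)
Lemma ev_equiv h : ract G (iota h) *m ev = ev *m ract N h.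
Proof.
apply: eq_mx_rowvec => v; rewrite mulmxA ract_ev mulmxA mul_ev.
rewrite -[iota h in LHS]mulr1 -rvec_ract -(mulmxA (rvec 1)).
rewrite eproj_equiv; last exact: is_mod_regmod.
by rewrite mulmxA -(mulmxA _ _ (phi_of v)) phi_of_hom mulmxA.
Qed.

Lemma ract_e_ev : ract G e *m ev = ev.
Proof.
by have := ev_equiv 1; rewrite iota1; case: mN => _ -> _; rewrite mulmx1.
Qed.

Lemma ev_monic (v : 'rV_(rdim G)) :
  (forall s, v *m ract G s *m ev = 0) -> v = 0.
Proof.
move=> v0; apply: phi_of_inj.
have -> : phi_of 0 = 0 by rewrite /phi_of mul0mx linear0.
rewrite -[LHS]mul1mx -(einc_eproj (is_mod_regmod S)) -mulmxA.
suff -> : eproj R *m phi_of v = 0 by rewrite mulmx0.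
by apply: eq_rvec_mx => x; rewrite mulmx0 mulmxA -ract_ev.
Qed.

(** Uniqueness half of the adjunction: the image of [f] is a submodule killed by [ev], so [ev_monic]
    applies to each of its vectors. *)
Lemma hom_ev_inj (M : rep K S) (f : 'M_(rdim M, rdim G)) :
  is_hom f -> f *m ev = 0 -> f = 0.
Proof.
move=> hf fev; apply: eq_mx_rowvec => v; rewrite mulmx0; apply: ev_monic => s.
by rewrite -(mulmxA v) -hf -!mulmxA fev !mulmx0.
Qed.

(** Existence half of the adjunction: [m] goes to [psi m], which sends [x] in [eS] to th(x m).
    Equivariance at [h = 1] makes [th] invariant under [e], so evaluation at [e] returns th(m). *)
Lemma ev_universal (M : rep K S) (th : 'M_(rdim M, rdim N)) : is_mod M ->
  (forall h, ract M (iota h) *m th = th *m ract N h) ->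
  exists f : 'M_(rdim M, rdim G), is_hom f /\ f *m ev = th.
Proof.
move=> mM hth; have mR := is_mod_regmod S.
pose psi (m : 'rV_(rdim M)) : 'M_(rdim eS, rdim N) := einc R *m orbmx m *m th.
have psi_lin : linear psi.
  move=> c u v; rewrite /psi.
  have -> : orbmx (c *: u + v) = c *: orbmx u + orbmx v.
    apply: eq_rvec_mx => x; rewrite mulmxDr -scalemxAr !rvec_orbmx //.
    by rewrite mulmxDl -scalemxAl.
  by rewrite mulmxDr mulmxDl -scalemxAr -scalemxAl.
have psi_hom m : is_hom (psi m).
  move=> h; rewrite /psi 2!mulmxA einc_equiv //.
  rewrite -(mulmxA (einc R) (ract R (iota h))) orbmx_hom //.
  by rewrite -[RHS]mulmxA -hth !mulmxA.
pose f : 'M_(rdim M, rdim G) := \matrix_j of_phi (psi (delta_mx 0 j)).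
have fE m : m *m f = of_phi (psi m).
  rewrite /f (mulmx_deltas (g := of_phi \o psi)) //.
  by move=> c u v; rewrite /= psi_lin of_phi_linear.
have phi_f m : phi_of (m *m f) = psi m by rewrite fE of_phiK.
exists f; split.
  move=> s; apply: eq_phi_of => m; rewrite mulmxA [in RHS]mulmxA.
  rewrite phi_f phi_of_ract phi_f /psi !mulmxA SFhom_einc //;
    last exact: rmulmx_hom.
  congr (_ *m _); rewrite -mulmxA; congr (_ *m _).
  apply: eq_rvec_mx => x; rewrite mulmxA rvec_rmulmx !rvec_orbmx //.
  by case: mM => _ _ ->; rewrite mulmxA.
apply: eq_mx_rowvec => m; rewrite mulmxA mul_ev phi_f /psi.
rewrite !mulmxA -(mulmxA (rvec 1)) eproj_einc rvec_ract mulr1 rvec_orbmx //.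
by rewrite -mulmxA -iota1 hth; case: mN => _ -> _; rewrite mulmx1.
Qed.

Lemma exists_corner_inv : exists r : S -> H, forall s, iota (r s) = e * s * e.
Proof.
(* The boolean equality lets [xchoose] extract a function. *)
have ex s : exists h, iota h == e * s * e.
  by have [h hE] := iota_onto s; exists h; apply/eqP.
by exists (fun s => xchoose (ex s)) => s; apply/eqP; exact: (xchooseP (ex s)).
Qed.

(** To reach [n], the map [x |-> (e x e) n] from [S] to [N] is factored through [G] by the universal
    property; the image of 1 in [G] then evaluates to [n]. *)
Lemma ev_full : row_full ev.
Proof.
have mR := is_mod_regmod S; have [r rE] := exists_corner_inv.
have [Nlin N1 Nmul] := mN.
apply/row_fullP.
suff: forall n : 'rV_(rdim N), exists v, v *m ev = n.
  move=> sur; have sub1 : (1%:M <= ev)%MS.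
    by apply/row_subP=> j; have [v <-] := sur (row j 1%:M); apply: submxMl.
  by exists (1%:M *m pinvmx ev); rewrite mulmxKpV.
move=> n.
pose t x := n *m ract N (r x).
have t_lin : linear t.
  move=> c x y; rewrite /t; have -> : r (c *: x + y) = c *: r x + r y.
    apply: iota_inj; rewrite iota_lin !rE mulrDr mulrDl.
    by rewrite -scalerAr -scalerAl.
  by rewrite Nlin mulmxDr -scalemxAr.
pose th : 'M_(rdim R, rdim N) := \matrix_(j < rdim R) t (vel (delta_mx 0 j)).
have thE x : rvec x *m th = n *m ract N (r x).
  exact: (vco_matrix x t_lin).
have hth h : ract R (iota h) *m th = th *m ract N h.
  apply: eq_rvec_mx => x; rewrite !mulmxA rvec_ract !thE -mulmxA -Nmul.
  congr (_ *m ract N _); apply: iota_inj.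
  by rewrite iotaM !rE !mulrA iota_el iota_er.
have [f [hf fev]] := ev_universal mR hth.
exists (rvec 1 *m f); rewrite -mulmxA fev thE.
have -> : r 1 = 1 by apply: iota_inj; rewrite rE mulr1 ee iota1.
by rewrite N1 mulmx1.
Qed.

Lemma counit_hom : is_hom (M := F G) (N := N) (einc G *m ev).
Proof.
move=> h; rewrite mulmxA einc_equiv; last exact: is_mod_SG.
by rewrite -[LHS]mulmxA ev_equiv mulmxA.
Qed.

Lemma eproj_counit : eproj G *m (einc G *m ev) = ev.
Proof. by rewrite mulmxA eproj_einc ract_e_ev. Qed.

(** Injectivity: if [w] in [e G] is killed by [ev], then ev(s w) = ev(e s e w) = h ev(w) = 0 for
    every [s], where [iota h = e * s * e], and [ev_monic] gives [w = 0]. Surjectivity comes from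
    that of [ev], which factors through [eproj]. *)
Lemma counit_iso : exists g : 'M_(rdim N, rdim (F G)),
  [/\ is_hom g, einc G *m ev *m g = 1%:M & g *m (einc G *m ev) = 1%:M].
Proof.
have mG := is_mod_SG; have [_ _ Gmul] := mG.
apply: hom_inverse; first exact: counit_hom.
  rewrite -kermx_eq0; apply/eqP; set k := kermx _.
  have kev : k *m einc G *m ev = 0 by rewrite -mulmxA mulmx_ker.
  apply: einc_monic; rewrite mul0mx; apply: eq_mx_rowvec => v; rewrite mulmx0.
  apply: ev_monic => s; set w := v *m _.
  have wev : w *m ev = 0 by rewrite /w -mulmxA kev mulmx0.
  have we : w *m ract G e = w by rewrite /w -2!mulmxA eincK.
  clearbody w; have [h hE] := iota_onto s.
  (* With [P] and [Q] the actions of [e] and [s], this replaces [s] by [e * s * e]. *)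
  have sandwich (P Q : 'M_(rdim G)) : w *m P = w -> P *m ev = ev ->
      w *m (P *m (Q *m P)) *m ev = w *m Q *m ev.
    by move=> wP Pev; rewrite -!mulmxA Pev !mulmxA wP.
  rewrite -(sandwich _ _ we ract_e_ev) -(Gmul e s) -Gmul -hE.
  by rewrite -mulmxA ev_equiv mulmxA wev mul0mx.
have := ev_full; rewrite -[X in row_full X]eproj_counit => /row_fullP[g gE].
by apply/row_fullP; exists (g *m eproj G); rewrite -mulmxA.
Qed.

End Coinduction.

(** * Full faithfulness and covers *)

(** The source is arbitrary because the property is applied to kernels and pullbacks, about which
    nothing more is known. *)
Definition ff_into N : Prop := forall M, is_mod M ->
  (forall f : 'M_(rdim M, rdim N), is_hom f -> Fhom f = 0 -> f = 0) /\
  (forall g : 'M_(rdim (F M), rdim (F N)), is_hom g ->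
     exists f : 'M_(rdim M, rdim N), is_hom f /\ Fhom f = g).

Lemma ff_eq M N (f g : 'M_(rdim M, rdim N)) : ff_into N -> is_mod M ->
  is_hom f -> is_hom g -> Fhom f = Fhom g -> f = g.
Proof.
move=> ffN mM hf hg fg; apply/eqP; rewrite -subr_eq0; apply/eqP.
by apply: (proj1 (ffN M mM)); [exact: homB | rewrite SFhomB fg subrr].
Qed.

(** Hom(M, G X) = Hom(F M, X) = Hom(F M, F G X), by the adjunction and then the counit. For
    fullness, [g] is followed by the counit and extended to [M] along [eproj]. *)
Lemma ff_SG X : is_mod X -> ff_into (SG iota e X).
Proof.
move=> mX M mM; set G := SG iota e X.
have mG : is_mod G by apply: is_mod_SG.
split=> [f hf f0|g hg].
  apply: (hom_ev_inj mX hf).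
  have cf0 : einc M *m f = 0 by rewrite -SFhom_einc // f0 mul0mx.
  rewrite -(ract_e_ev mX) mulmxA -hf -(eproj_einc M) -(mulmxA (eproj M)) cf0.
  by rewrite mulmx0 mul0mx.
have [k' [hk' kk' k'k]] := counit_iso mX.
set k := einc G *m ev X in kk' k'k.
have hgk : is_hom (M := F M) (N := X) (g *m k).
  exact: (hom_comp hg (counit_hom mX)).
have [|f [hf fE]] := ev_universal mX (M := M) (th := eproj M *m (g *m k)) mM.
  by move=> h; rewrite mulmxA eproj_equiv // -[LHS]mulmxA hgk mulmxA.
exists f; split=> //.
rewrite -[LHS]mulmx1 -[RHS]mulmx1 -kk' !mulmxA; congr (_ *m _).
by rewrite SFhom_einc // -(mulmxA (einc M)) fE !mulmxA einc_eproj // mul1mx.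
Qed.

(** A five lemma in which the Ext^1 terms are replaced by an explicit pullback. *)
Lemma ff_ext N1 N N2 (i : 'M_(rdim N1, rdim N)) (p : 'M_(rdim N, rdim N2)) :
  is_mod N1 -> is_mod N -> is_mod N2 -> ses i p ->
  ff_into N1 -> ff_into N2 -> ff_into N.
Proof.
move=> m1 mN m2 ip ff1 ff2 M mM.
have [hi hp ifree pfull kE] := ip.
have Fip := SFhom_ses m1 mN m2 ip; have [hFi hFp Fifree _ _] := Fip.
have faith Z (f : 'M_(rdim Z, rdim N)) : is_mod Z -> is_hom f ->
    Fhom f = 0 -> f = 0.
  move=> mZ hf f0.
  have fp0 : f *m p = 0.
    apply: (proj1 (ff2 Z mZ)); first exact: (hom_comp hf hp).
    by rewrite SFhomM // f0 mul0mx.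
  have [f1 [hf1 f1E]] := ses_factor ip hf fp0.
  suff f10 : f1 = 0 by rewrite -f1E f10 mul0mx.
  apply: (proj1 (ff1 Z mZ)) => //; apply: (row_free_inj Fifree).
  by rewrite mul0mx -SFhomM // f1E.
split=> [f|g hg]; first exact: faith.
have [f2 [hf2 f2E]] := proj2 (ff2 M mM) _ (hom_comp hg hFp).
(* On the pullback [E] of [f2] and [p] the two maps [FE -> FN] agree modulo
   [F N1], so after a correction by [E -> N1] the one through [N] lifts [g]. *)
have [E [r [s [mE hr hs rs [_ sur]]]]] := exists_pullback mM mN hf2 hp.
have rfull : row_full r.
  have [|w [wr _]] := sur _ 1%:M (f2 *m pinvmx p); last first.
    by apply/row_fullP; exists w.
  by rewrite -mulmxA mulVpmx // mulmx1 mul1mx.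
have hFr := SFhom_hom mE mM hr; have hFs := SFhom_hom mE mN hs.
have hFrg := hom_comp hFr hg.
have [|d [hd dE]] := ses_factor Fip (homB hFrg hFs).
  rewrite mulmxBl -[X in X - _]mulmxA -f2E -!SFhomM // rs.
  by rewrite subrr.
have [c [hc cE]] := proj2 (ff1 E mE) _ hd.
have hci : is_hom (M := E) (N := N) (c *m i) by apply: (hom_comp hc hi).
pose u := s + c *m i; have hu : is_hom u by apply: homD.
have uE : Fhom u = Fhom r *m g.
  by rewrite SFhomD SFhomM // cE dE addrCA subrr addr0.
(* By faithfulness [u] kills the kernel of [r], since its image under [F] is [F r] followed by [g];
   so [u] descends to [M]. *)
have [Z [k [mZ hk kfree kerk]]] := exists_kernel mE hr.
have kr : k *m r = 0 by apply/sub_kermxP; rewrite (eqmxP kerk).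
have ku : k *m u = 0.
  apply: faith => //; first exact: (hom_comp hk hu).
  by rewrite SFhomM // uE mulmxA -SFhomM // kr SFhom0 mul0mx.
have [|f [hf fE]] := hom_descend hr rfull hu.
  by rewrite -(eqmxP kerk); apply/sub_kermxP.
exists f; split=> //.
by apply: (row_full_inj (SFhom_full mE mM hr rfull)); rewrite -SFhomM // fE.
Qed.

Lemma ff_retract N N' (s : 'M_(rdim N, rdim N')) (r : 'M_(rdim N', rdim N)) :
  is_mod N -> is_mod N' -> is_hom s -> is_hom r -> s *m r = 1%:M ->
  ff_into N' -> ff_into N.
Proof.
move=> mN mN' hs hr sr ff M mM; split=> [f hf f0|g hg].
  suff fs0 : f *m s = 0 by rewrite -[f]mulmx1 -sr mulmxA fs0 mul0mx.
  apply: (proj1 (ff M mM)); first exact: (hom_comp hf hs).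
  by rewrite SFhomM // f0 mul0mx.
have [f [hf fE]] := proj2 (ff M mM) _ (hom_comp hg (SFhom_hom mN mN' hs)).
exists (f *m r); split; first exact: (hom_comp hf hr).
by rewrite SFhomM // fE -mulmxA -SFhomM // sr SFhom1 // mulmx1.
Qed.

Lemma ff_dim0 N : rdim N = 0%N -> ff_into N.
Proof.
move=> N0 M mM; have thin m (f : 'M[K]_(m, rdim N)) : f = 0.
  by move: f; rewrite N0; apply: thinmx0.
split=> [f _ _|g hg]; first exact: thin.
exists 0; split; first exact: hom0.
rewrite SFhom0 -[RHS]mulmx1.
have -> : (1%:M : 'M[K]_(rdim (F N))) = 0; last by rewrite mulmx0.
by apply: einc_monic; rewrite [LHS]thin [RHS]thin.
Qed.

Lemma SF_dim0 N : rdim N = 0%N -> rdim (F N) = 0%N.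
Proof.
by move=> N0; apply/eqP; rewrite -leqn0 -N0 -(eqP (einc_free N)) rank_leq_col.
Qed.

Lemma lifts_dim0 (Q X : rep K H) : rdim X = 0%N -> lifts Q X.
Proof.
move=> X0 Y Z i p f mY mZ [hi hp ifree pfull kE] hf.
have i0 : i = 0.
  by move: (i : 'M[K]_(rdim X, rdim Y)); rewrite X0 => j; apply: flatmx0.
have pfree : row_free p.
  by rewrite -kermx_eq0 -submx0 -(eqmxP kE) i0 sub0mx.
by apply: hom_factor => //; apply: submx_full.
Qed.

(** * Filtered modules, projective modules and extensions *)

Section Cover.
Variables (d : Order.disp_t) (L : finPOrderType d) (W : L -> rep K H).
Hypothesis mW : forall l, is_mod (W l).
Hypothesis hw : highest_weight (fun l => SG iota e (W l)).
Hypothesis R1W : forall l, R1G_zero iota e (W l).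

Local Notation D := (fun l : L => SG iota e (W l)).
Local Notation R := (regmod S).

Lemma Dfilt_ff (B : pred L) N : Dfilt D B N -> is_mod N -> ff_into N.
Proof.
elim=> {N} [N N0 _|N N' l i p _ mN' _ IH ip mN]; first exact: ff_dim0.
apply: (ff_ext mN' mN _ ip (IH mN')); first exact: is_mod_SG.
exact: ff_SG.
Qed.

(** This is R^1 G(F N) = 0, by induction on the filtration: [F] of a standard module is isomorphic
    to [W l] through the counit. *)
Lemma Dfilt_lifts (B : pred L) N : Dfilt D B N -> is_mod N -> lifts (F R) (F N).
Proof.
elim=> {N} [N N0 _|N N' l i p _ mN' _ IH ip mN].
  exact/lifts_dim0/SF_dim0.
apply: (lifts_ext (SFhom_ses mN' mN _ ip) (IH mN')); first exact: is_mod_SG.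
have [k [hk kk' k'k]] := counit_iso (mW l).
apply: (lifts_iso (N' := W l)).
  exists (einc (SG iota e (W l)) *m ev (W l)), k.
  by split=> //; apply: counit_hom.
exact: (Ext1_zero_lifts (is_mod_SF (is_mod_regmod S)) (@R1W l)).
Qed.

(** As long as [f : M -> N] is not onto, (H3) gives a nonzero map from a standard module to its
    cokernel. Composed with P(l) -> Delta(l), it lifts to [N] by projectivity, and adding P(l) to
    [M] enlarges the image. *)
Lemma exists_ff_cover N : is_mod N ->
  exists (M : rep K S) (f : 'M_(rdim M, rdim N)),
    [/\ is_mod M, ff_into M, is_hom f & row_full f].
Proof.
move=> mN; have [_ _ _ H3 H4] := hw.
(* [n] bounds the codimension of the image; the induction starts from the zero module. *)
have main n : forall (M : rep K S) (f : 'M_(rdim M, rdim N)),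
    is_mod M -> ff_into M -> is_hom f -> (rdim N - \rank f <= n)%N ->
  exists (M : rep K S) (f : 'M_(rdim M, rdim N)),
    [/\ is_mod M, ff_into M, is_hom f & row_full f].
  elim: n => [|n IH] M f mM ffM hf fn.
    exists M, f; split=> //; rewrite /row_full eqn_leq rank_leq_col.
    by rewrite -subn_eq0 -leqn0.
  have stab a : (f *m ract N a <= f)%MS by rewrite -hf submxMl.
  have [C [c [mC hc cfull kc]]] := exists_quotient mN stab.
  have [ffull|fnfull] := boolP (row_full f); first by exists M, f.
  have [l [g [hg gn0]]] : exists l (g : 'M_(rdim (D l), rdim C)),
      is_hom g /\ g <> 0.
    apply: NNPP => none; case/negP: fnfull.
    suff C0 : rdim C = 0%N.
      rewrite -sub1mx (eqmxP kc); apply/sub_kermxP.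
      by move: (1%:M *m c); rewrite C0; apply: thinmx0.
    apply: H3 => // l g hg; apply: NNPP => gn0; apply: none.
    by exists l, g.
  have [P [p [Q [i [mP projP mQ ip DQ]]]]] := H4 l.
  have [hi hp _ pfull _] := ip.
  have mDl : is_mod (D l) by apply: is_mod_SG.
  have ffP : ff_into P.
    by apply: (ff_ext mQ mP mDl ip (Dfilt_ff DQ mQ)); apply: ff_SG.
  have [h [hh hcE]] := projP _ _ c _ mN mC hc cfull (hom_comp hp hg).
  have [E [a [b [r [s [[mE hr [hb bs] hs ases] ar]]]]]] := exists_dsum mM mP.
  have hrf := hom_comp hr hf; have hsh := hom_comp hs hh.
  pose f' := r *m f + s *m h.
  have hf' : is_hom (M := E) (N := N) f' by apply: homD hrf hsh.
  have ff' : (f <= f')%MS.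
    apply/submxP; exists a.
    by rewrite mulmxDr !mulmxA ar mul1mx (ses0 ases) mul0mx addr0.
  apply: (IH E f') => //; first exact: (ff_ext mM mE mP ases).
  rewrite -ltnS; apply: leq_trans fn; apply: ltn_sub2l.
    by rewrite ltn_neqAle rank_leq_col andbT.
  (* If the rank did not grow, the image of [f'] would lie in that of [f]; then [h] would vanish in
     the cokernel [C], and so would [g]. *)
  rewrite ltnNge; apply/negP => rk.
  have f'f : (f' <= f)%MS by rewrite -(geq_leqif (mxrank_leqif_sup ff')).
  case: gn0; apply: (row_full_inj pfull); rewrite mulmx0 -hcE.
  apply/sub_kermxP; rewrite -(eqmxP kc).
  have f'c : f' *m c = 0 by apply/sub_kermxP; rewrite -(eqmxP kc).
  have fc : f *m c = 0 by apply/sub_kermxP; rewrite -(eqmxP kc).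
  have shc : s *m h *m c = 0.
    by move: f'c; rewrite mulmxDl -(mulmxA r) fc mulmx0 add0r.
  rewrite (eqmxP kc); apply/sub_kermxP.
  by rewrite -[h]mul1mx -bs -2!mulmxA (mulmxA s) shc mulmx0.
pose Z : rep K S := @Rep K S 0 (fun _ => 0).
apply: (main (rdim N) Z 0); last by rewrite mxrank0 subn0.
- by split=> *; rewrite [LHS]flatmx0 [RHS]flatmx0.
- exact: ff_dim0.
exact: hom0.
Qed.

Lemma proj_ff N : is_mod N -> is_proj N -> ff_into N.
Proof.
move=> mN pN; have [M [f [mM ffM hf ffull]]] := exists_ff_cover mN.
have [s [hs sf]] := pN _ _ f 1%:M mM mN hf ffull (@hom1 _ _ N).
exact: (ff_retract mN mM hs hf sf ffM).
Qed.

(** [E2] inherits full faithfulness as an extension of [M] by [N], so the equivalence lifts, and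
    faithfulness reflects its two identities. *)
Lemma ext_equiv_reflect M N (E1 E2 : rep K S)
    (i1 : 'M_(rdim N, rdim E1)) (p1 : 'M_(rdim E1, rdim M))
    (i2 : 'M_(rdim N, rdim E2)) (p2 : 'M_(rdim E2, rdim M)) :
  is_mod M -> is_mod N -> is_mod E1 -> is_mod E2 -> ff_into M -> ff_into N ->
  ses i1 p1 -> ses i2 p2 ->
  ext_equiv (Fhom i1) (Fhom p1) (Fhom i2) (Fhom p2) -> ext_equiv i1 p1 i2 p2.
Proof.
move=> mM mN m1 m2 ffM ffN ip1 ip2 [g [hg ig gp]].
have [hi1 hp1 _ _ _] := ip1; have [hi2 hp2 _ _ _] := ip2.
have ff2 := ff_ext mN m2 mM ip2 ffN ffM.
have [f [hf fE]] := proj2 (ff2 _ m1) _ hg.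
exists f; split=> //.
  apply: (ff_eq ff2 mN) => //; first exact: (hom_comp hi1 hf).
  by rewrite SFhomM // fE.
apply: (ff_eq ffM m1) => //; first exact: (hom_comp hf hp2).
by rewrite SFhomM // fE.
Qed.

(** The middle term is [G E'], and the counit gives the required equivalence. Exactness at the left
    and in the middle comes from full faithfulness into [N], surjectivity at the right from the
    lifting property. *)
Lemma ext_lift M N (E' : rep K H) (i' : 'M_(rdim (F N), rdim E'))
    (p' : 'M_(rdim E', rdim (F M))) :
  is_mod M -> is_mod N -> ff_into M -> ff_into N -> lifts (F R) (F N) ->
  is_mod E' -> ses i' p' ->
  exists (E : rep K S) (i : 'M_(rdim N, rdim E)) (p : 'M_(rdim E, rdim M)),
    [/\ is_mod E, ses i p & ext_equiv (Fhom i) (Fhom p) i' p'].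
Proof.
move=> mM mN ffM ffN liftN mE' ip'.
have [hi' hp' i'free p'full kE'] := ip'.
pose E := SG iota e E'; have mE : is_mod E by apply: is_mod_SG.
have ffE : ff_into E by apply: ff_SG.
have mR := is_mod_regmod S.
have hk := counit_hom mE'; have [k' [hk' kk' k'k]] := counit_iso mE'.
have kev := eproj_counit mE'.
set k := einc E *m ev E' in hk kk' k'k kev.
have kinj m (a b : 'M_(m, rdim (F E))) : a *m k = b *m k -> a = b.
  by move=> ab; rewrite -[a]mulmx1 -kk' mulmxA ab -mulmxA kk' mulmx1.
(* [i] lifts [i'] followed by the inverse counit, and [p] lifts the counit followed by [p']. *)
have [i [hi iE]] := proj2 (ffE N mN) _ (hom_comp hi' hk').
have [p [hp pE]] := proj2 (ffM E mE) _ (hom_comp hk hp').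
have ik : Fhom i *m k = i' by rewrite iE -mulmxA k'k mulmx1.
exists E, i, p; split=> //; last by exists k; split.
split=> //.
- have [X [j [mX hj jfree kerj]]] := exists_kernel mN hi.
  have ji : j *m i = 0 by apply/sub_kermxP; rewrite (eqmxP kerj).
  suff j0 : j = 0 by rewrite -kermx_eq0 -submx0 -(eqmxP kerj) j0 sub0mx.
  apply: (proj1 (ffN X mX)) => //; apply: (row_free_inj i'free).
  by rewrite mul0mx -ik mulmxA -SFhomM // ji SFhom0 mul0mx.
- have [p1 p1E] : exists q : 'M_(rdim M, rdim E), q *m p = 1%:M.
    suff : (1%:M <= p)%MS by case/submxP=> q; exists q.
    (* [m] is the value at [1] of [S -> M, x |-> x m], whose restriction to
       [eS] lifts to [E']. *)
    apply/row_subP=> j; set m := row j _.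
    have ho := orbmx_hom m mM; have hFo := SFhom_hom mR mM ho.
    have [g [hg gp]] := liftN _ _ _ _ _ mE' (is_mod_SF mM) ip' hFo.
    have [u [hu uE]] := proj2 (ffE R mR) _ (hom_comp hg hk').
    have up : u *m p = orbmx m.
      apply: (ff_eq ffM mR) => //; first exact: (hom_comp hu hp).
      by rewrite SFhomM // uE pE -mulmxA (mulmxA k') k'k mul1mx.
    have mE1 : rvec 1 *m orbmx m = m.
      by rewrite rvec_orbmx //; case: mM => _ -> _; rewrite mulmx1.
    by rewrite -mE1 -up mulmxA submxMl.
  by apply/row_fullP; exists p1.
apply/andP; split.
  apply/sub_kermxP; apply: (proj1 (ffM N mN)); first exact: (hom_comp hi hp).
  by rewrite SFhomM // pE mulmxA ik (ses0 ip').
(* The map from [F X] to [E'] factors through [F N]; fullness into [N] lifts this to [u : X -> N],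
   through which the kernel of [p] factors. *)
have [X [j [mX hj jfree kerj]]] := exists_kernel mE hp.
have jp : j *m p = 0 by apply/sub_kermxP; rewrite (eqmxP kerj).
have hjk := hom_comp (SFhom_hom mX mE hj) hk.
have [|g [hg gi]] := ses_factor ip' hjk.
  by rewrite -mulmxA -pE -SFhomM // jp SFhom0.
have [u [hu uE]] := proj2 (ffN X mX) _ hg.
have ui : u *m i = j.
  apply: (ff_eq ffE mX) => //; first exact: (hom_comp hu hi).
  by apply: kinj; rewrite SFhomM // -mulmxA ik uE gi.
by rewrite -(eqmxP kerj) -ui submxMl.
Qed.

End Cover.

(** [P] is [S e], the image of right multiplication by [e], with inclusion [b] and projection [q].
    As a retract of [S] it is projective, and its endomorphisms are the right multiplications by
    elements of [eSe]. *)
Lemma corner_End : exists (P : rep K S) (phi : H -> 'M[K]_(rdim P)),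
  [/\ is_mod P /\ is_proj P,
      (forall (c : K) (a b : H), phi (c *: a + b) = c *: phi a + phi b),
      injective phi,
      (forall h, is_hom (phi h)) /\ (forall f, is_hom f -> exists h, phi h = f)
    & phi 1 = 1%:M /\ forall a b, phi (a * b) = phi a *m phi b].
Proof.
have mR := is_mod_regmod S.
have stab a : (rmulmx e *m ract (regmod S) a <= rmulmx e)%MS.
  by rewrite -(rmulmx_hom e) submxMl.
have [P [b [mP hb bfree bE]]] := exists_submodule mR stab.
have hre := rmulmx_hom e.
have [|q [hq qb]] := hom_factor hb bfree hre; first by rewrite (eqmxP bE).
have be : b *m rmulmx e = b.
  have /submxP[c ->] : (b <= rmulmx e)%MS by rewrite (eqmxP bE).
  by rewrite -mulmxA -rmulmxM ee.
have bq : b *m q = 1%:M.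
  by apply: (row_free_inj bfree); rewrite -mulmxA qb be mul1mx.
have eqq : rmulmx e *m q = q by rewrite -qb -mulmxA bq mulmx1.
pose phi h : 'M_(rdim P) := b *m rmulmx (iota h) *m q.
have phib h : phi h *m b = b *m rmulmx (iota h).
  by rewrite /phi -mulmxA qb -mulmxA -rmulmxM iota_er.
have hphi h : is_hom (phi h).
  exact: (hom_comp (hom_comp hb (rmulmx_hom (iota h))) hq).
exists P, phi; split.
- split=> // M N p f mM mN hp pfull hf.
  (* [n] is the image of 1 under [S -> P -> N]; a preimage [m] of it under [p] defines a lift on
     [S], which is then restricted along [b]. *)
  pose n := rvec 1 *m (q *m f).
  have qf : q *m f = orbmx n.
    apply: eq_rvec_mx => x; rewrite rvec_orbmx // /n -mulmxA.
    have hqf := hom_comp hq hf.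
    by rewrite -hqf [RHS]mulmxA rvec_ract mulr1.
  have [m mp] : exists m, m *m p = n.
    by exists (n *m pinvmx p); rewrite -mulmxA mulVpmx ?mulmx1.
  exists (b *m orbmx m); split; first exact: (hom_comp hb (orbmx_hom m mM)).
  rewrite -[f]mul1mx -bq -!mulmxA; congr (_ *m _); rewrite qf.
  apply: eq_rvec_mx => x.
  by rewrite mulmxA !rvec_orbmx // -mulmxA hp mulmxA mp.
- move=> c x y; rewrite /phi iota_lin rmulmxP mulmxDr mulmxDl.
  by rewrite -scalemxAr -scalemxAl.
- move=> x y xy; apply: iota_inj; apply: rmulmx_inj.
  have qphi h : q *m phi h *m b = rmulmx (iota h).
    by rewrite -mulmxA phib mulmxA qb -rmulmxM iota_el.
  by rewrite -!qphi xy.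
- split=> // f hf.
  (* Extended to [S] as [q f b], the endomorphism is right multiplication by the image [s] of 1; on
     [S e] it agrees with right multiplication by [e s e]. *)
  have hg := hom_comp hq (hom_comp hf hb).
  have [s sE] : exists s : S, rvec s = rvec 1 *m (q *m (f *m b)).
    by exists (vel (rvec 1 *m (q *m (f *m b)))); apply: velK.
  have gE : q *m (f *m b) = rmulmx s.
    apply: eq_rvec_mx => x; rewrite rvec_rmulmx.
    by rewrite -rvec_ract sE -mulmxA -hg [RHS]mulmxA rvec_ract mulr1.
  have [h hE] := iota_onto s.
  exists h; apply: (row_free_inj bfree); rewrite phib hE !rmulmxM -gE.
  by rewrite !mulmxA be bq mul1mx -mulmxA be.
split; first by rewrite /phi iota1 -mulmxA eqq bq.
move=> x y; apply: (row_free_inj bfree).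
by rewrite phib iotaM rmulmxM -[RHS]mulmxA phib [RHS]mulmxA phib mulmxA.
Qed.

(** * Verification of the cover conditions *)

Lemma SF_1cover (d : Order.disp_t) (L : finPOrderType d) (W : L -> rep K H) :
  (forall l, is_mod (W l)) ->
  highest_weight (fun l => SG iota e (W l)) ->
  (forall l, R1G_zero iota e (W l)) ->
  is_1cover iota e (fun l => SG iota e (W l)).
Proof.
move=> mW hw R1W; split.
- by move=> M1 M2 M3 i p; apply: SFhom_ses.
- exact: corner_End.
- move=> M N mM mN _ pN; have ffN := proj_ff mW hw mN pN.
  split=> [f g|]; [exact: ff_eq | exact: (proj2 (ffN M mM))].
move=> M N mM mN DM DN.
have ffM := Dfilt_ff mW DM mM; have ffN := Dfilt_ff mW DN mN.
split=> [E1 E2 i1 p1 i2 p2 m1 m2|E' i' p'].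
  exact: ext_equiv_reflect.
by apply: ext_lift => //; apply: Dfilt_lifts mW R1W _ _ DN mN.
Qed.

End SchurFunctor.

(** Transposition reverses products, and the anti-automorphism reverses them back. *)
Lemma is_mod_dualmod (K : fieldType) (A : falgType K) (st : A -> A)
    (M : rep K A) : is_alg_antiauto st -> is_mod M -> is_mod (dualmod st M).
Proof.
move=> [st_lin _ st1 stM] [Mlin M1 Mmul]; split=> [c a b| |a b] /=.
- by rewrite st_lin Mlin linearP.
- by rewrite st1 M1 trmx1.
by rewrite stM Mmul trmx_mul.
Qed.

Unset Implicit Arguments.
Set Strict Implicit.

Theorem theorem8p5 (K : fieldType) (S H : falgType K) (e : S) (iota : H -> S)
    (d : Order.disp_t) (L : finPOrderType d)
    (Sp : L -> rep K H) (sh st : H -> H) (t : L -> L) :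
  e * e = e ->
  (* e S e ~= H via iota *)
  (forall (c : K) (a b : H), iota (c *: a + b) = c *: iota a + iota b) ->
  injective iota ->
  iota 1 = e ->
  (forall a b : H, iota (a * b) = iota a * iota b) ->
  (forall s : S, exists h : H, iota h = e * s * e) ->
  (* H admits dual Specht modules S_lam := (Sp lam)^* *)
  admits_dual_Specht Sp sh st t ->
  (* S-mod is highest weight with standard modules Delta(lam) := G(S_lam) *)
  highest_weight (fun l => SG iota e (dualmod st (Sp l))) ->
  (* R^1 G (S_lam) = 0 *)
  (forall l, R1G_zero iota e (dualmod st (Sp l))) ->
  is_1cover iota e (fun l => SG iota e (dualmod st (Sp l))).
Proof.
move=> ee iota_lin iota_inj iota1 iotaM iota_onto.
move=> [mSp _ _ [_ antist _ _] _] hw R1.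
by apply: SF_1cover => // l; apply: is_mod_dualmod.
Qed.
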